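(* There is an infinite sequence $\Sigma_1, \Sigma_2, \dots, \Sigma_i, \dots$ of contradictory (unsatisfiable) finite sets of clauses and a corresponding list of positive integer parameters $n(1), n(2), \dots, n(i), \dots$ with $n(i) \to \infty$, so that (abbreviating $n(i)$ as $n$): (1) each clause set $\Sigma_i$ contains $n-1$ variables and $n^{O(\log^4 n)}$ clauses with width $O(\log^5 n)$; (2) $\Sigma_i$ has a regular tree-style resolution refutation with size $n^{O(\log^4 n)}$; (3) any regular resolution refutation of $\Sigma_i$ must contain a clause with width $\Omega(n/\log n)$.
   Context: $\log$ is the base-2 logarithm and $\log^k x = (\log x)^k$. The implicit constants in $O(\cdot)$ and $\Omega(\cdot)$ are absolute, and the bounds are asymptotic (for all sufficiently large $i$). A literal is a propositional variable $x$ or its negation $\neg x$. A clause is a finite set of literals, interpreted as their disjunction; its width is the number of literals in it. The resolution rule derives $C \vee D$ from $C \vee x$ and $D \vee \neg x$ (resolving on $x$). A resolution derivation of a clause $C$ from a set of clauses $\Sigma$ is a sequence of clauses, each of which is either a clause of $\Sigma$ or derived from earlier clauses by resolution, with last clause $C$; it is a refutation of $\Sigma$ if $C$ is the empty clause. The size of a resolution proof is the number of occurrences of clauses in it (its length as a sequence). A proof is tree-style if every clause (occurrence) in it is used at most once as a premiss of a resolution inference. An irregularity in a resolution proof is a sequence of clauses $C_1, \dots, C_k$ of the proof ($k \geq 3$) such that each $C_{i+1}$ is derived from $C_i$ (that is, $C_i$ is one of the premisses of the resolution inference with conclusion $C_{i+1}$), and there is a variable that occurs in $C_1$ and in $C_k$,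 but not in any intermediate clause $C_j$, $1<j<k$. A resolution proof is regular if it contains no irregularity. *)

(* Defs.v *)
From mathcomp Require Import all_boot all_order all_algebra finmap.
From mathcomp Require Import all_classical all_reals all_analysis.

Set Implicit Arguments.
Unset Strict Implicit.
Unset Printing Implicit Defensive.

Local Open Scope fset_scope.

(* The literal (x, true) is the propositional variable x; (x, false) is its
   negation. *)
Definition literal := (nat * bool)%type.
Definition clause := {fset literal}.
Definition clause_set := {fset clause}.

Definition width (C : clause) : nat := #|` C|.

Definition clause_vars (C : clause) : {fset nat} := [fset l.1 | l in C].
Definition vars (S : clause_set) : {fset nat} :=
  [fset l.1 | C in S, l in (C : clause)].

Definition clause_sat (v : nat -> bool) (C : clause) : Prop :=
  exists2 l, l \in C & v l.1 = l.2.
Definition contradictory (S : clause_set) : Prop :=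
  forall v : nat -> bool, ~ (forall C, C \in S -> clause_sat v C).

(* A proof is a sequence of clause occurrences, each carrying its
   justification: [Resolve x j k] is the resolution on x of the occurrences at
   positions j (containing x) and k (containing the negation of x).  Recording
   the inference fixes which occurrences are the premisses of which. *)
Inductive justification := Initial | Resolve of nat & nat & nat.

Record line := Line { concl : clause; just : justification }.
Definition proof := seq line.

Definition line0 := Line fset0 Initial.
Definition clause_at (p : proof) (i : nat) : clause := concl (nth line0 p i).
Definition proof_clauses (p : proof) : seq clause := [seq concl l | l <- p].

Definition resolvent (x : nat) (A B : clause) : clause :=
  (A `\ (x, true)) `|` (B `\ (x, false)).

Definition valid_line (S : clause_set) (p : proof) (i : nat) : Prop :=
  match just (nth line0 p i) with
  | Initial => clause_at p i \in S
  | Resolve x j k =>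
      [/\ j < i, k < i,
          (x, true) \in clause_at p j, (x, false) \in clause_at p k
        & clause_at p i = resolvent x (clause_at p j) (clause_at p k)]
  end.

Definition derivation (S : clause_set) (p : proof) (C : clause) : Prop :=
  [/\ 0 < size p, (forall i, i < size p -> valid_line S p i)
    & concl (last line0 p) = C].
Definition refutation (S : clause_set) (p : proof) : Prop :=
  derivation S p fset0.

Definition premisses (l : line) : seq nat :=
  if just l is Resolve _ j k then [:: j; k] else [::].

(* Every use of an occurrence as a premiss is listed once, so an inference
   with the same occurrence as both premisses uses it twice. *)
Definition tree_style (p : proof) : Prop :=
  uniq (flatten [seq premisses l | l <- p]).

Definition premiss_of (p : proof) : rel nat :=
  fun j i => j \in premisses (nth line0 p i).

(* s lists the positions in p of the clauses of the irregularity. *)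
Definition irregularity (p : proof) (s : seq nat) : Prop :=
  [/\ 3 <= size s, sorted (premiss_of p) s
    & exists x : nat,
        [/\ x \in clause_vars (clause_at p (head 0 s)),
            x \in clause_vars (clause_at p (last 0 s))
          & forall j, 0 < j < (size s).-1 ->
              x \notin clause_vars (clause_at p (nth 0 s j))]].

Definition regular (p : proof) : Prop := ~ exists s, irregularity p s.

Definition log2 (R : realType) (x : R) : R := (ln x / ln 2)%R.

(* Main.v *)
(* A width lower bound for regular proofs that fails for general ones comes from
   making forgetting fatal.  Take the pebbling clauses "D(v) implies v" of an
   acyclic graph on N = 2^k vertices, together with the negation of the sink, and
   replace each of them by all its weakenings with the sign patterns over a set
   mu(v) of O(log N) variables.  Querying the vertices in topological order, and
   mu(v) at the first false v, is a decision tree of size N 2^O(log N), hence a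
   regular tree-style refutation.

   Conversely, read a regular refutation from the empty clause upwards, against
   an adversary answering the queries.  A variable that was queried and no longer
   occurs in the current clause can never occur again.  If all clauses are
   narrow, then after q of the order of N / log N queries at least q / 2
   variables are forgotten; mu is an expander, so for all but N / 8 vertices v
   the set mu(v) contains a forgotten variable, and no initial clause of these v
   can be reached any more.  So the adversary wins by surviving q queries and
   then completing its answers to an assignment whose only falsified clause
   belongs to a vertex that is neither queried nor exceptional.

   To this end it maintains a path of false vertices from the sink down to the
   largest vertex that is good for the set Q of queried variables, everything
   else being true.  A vertex is good if Q is sparse around it at all dyadic
   scales; each scale spoils O(|Q|) vertices, O(k |Q|) in all.  In the graph
   of Erdos, Graham and Szemeredi (expanders between consecutive dyadic blocks at
   all scales) any two good vertices are joined by a path avoiding Q. *)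
Require Import Defs.
From mathcomp Require Import all_boot all_order all_algebra finmap.
From mathcomp Require Import all_classical all_reals all_analysis.
From mathcomp Require Import zify.

Set Implicit Arguments.
Unset Strict Implicit.
Unset Printing Implicit Defensive.

Import Order.TTheory GRing.Theory Num.Theory.

Local Open Scope fset_scope.
Local Open Scope nat_scope.

(** * Expanders by counting *)

(** The first two terms of the binomial expansion of [(g + 1) ^ g] are both equal to [g ^ g]. *)
Lemma double_expn_le g : 0 < g -> 2 * g ^ g <= g.+1 ^ g.
Proof.
case: g => // g _.
rewrite -[in leqRHS]addn1 expnDn big_ord_recl big_ord_recl /=.
rewrite bin0 bin1 !exp1n !muln1 mul1n subn0 /bump /= subSS subn0.
by rewrite addnA -expnS addnn -mul2n leq_addr.
Qed.

(** In probabilistic terms, [g] independent draws all miss a set of density at least [1 / g] with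
    probability at most 1/2. The reason is [(g + 1) * a <= g * s]. *)
Lemma expn_codensity_le g s a b :
  0 < g -> a + b = s -> s <= g * b -> 2 * a ^ g <= s ^ g.
Proof.
move=> g_gt0 sE s_le; rewrite -(@leq_pmul2l (g ^ g)) ?expn_gt0 ?g_gt0 //.
have h : (g.+1 * a) ^ g <= (g * s) ^ g by rewrite leq_exp2r //; nia.
rewrite !expnMn in h.
by apply: leq_trans h; rewrite mulnCA mulnA leq_mul2r double_expn_le ?orbT.
Qed.

(* Union bound: by expn_codensity_le a given pair (E, F) is unlinked for at most a
   fraction 2 ^ - (17 * #|E|) < 4 ^ - s of the maps h, and there are 4 ^ s pairs. *)
Lemma expander_ffun g s : 0 < g -> 0 < s ->
  exists h : {ffun 'I_s * 'I_(17 * g) -> 'I_s}, forall E F : {set 'I_s},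
    s <= 8 * #|E| -> s <= g * #|F| ->
    exists2 i, i \in E & exists l, h (i, l) \in F.
Proof.
move=> g_gt0 s_gt0; set m := 17 * g.
(* [family (fam E F)] is the set of maps without an edge from [E] to [F]. *)
pose fam (E F : {set 'I_s}) (il : 'I_s * 'I_m) : pred 'I_s :=
  if il.1 \in E then [pred j | j \notin F] else predT.
pose big (p : {set 'I_s} * {set 'I_s}) := (s <= 8 * #|p.1|) && (s <= g * #|p.2|).
have card_fam E F : big (E, F) -> 2 * 4 ^ s * #|family (fam E F)| <= s ^ (s * m).
  move=> /andP[/= E8 Fg].
  have cE : #|~: E| = s - #|E| by rewrite cardsCs finset.setCK card_ord.
  have leE : #|E| <= s by rewrite -[leqRHS]card_ord max_card.
  have -> : #|family (fam E F)| = (#|~: F| ^ m) ^ #|E| * (s ^ m) ^ (s - #|E|).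
    rewrite card_family foldrE big_map big_enum /=.
    rewrite (eq_bigr (fun il => (fun i l => #|fam E F (i, l)|) il.1 il.2)); last by case.
    rewrite -(pair_bigA _ (fun i (l : 'I_m) => #|fam E F (i, l)|)) /= (bigID (mem E)) /=.
    rewrite (eq_bigr (fun=> #|~: F| ^ m)); last first.
      move=> i iE; rewrite /fam /= iE prod_nat_const card_ord; congr (_ ^ _).
      by apply: eq_card => j; rewrite !inE.
    rewrite [X in _ * X](eq_bigr (fun=> s ^ m)); last first.
      by move=> i /negbTE iE; rewrite /fam /= iE prod_nat_const !card_ord.
    rewrite !prod_nat_const -cE; congr (_ * _ ^ _).
    by apply: eq_card => j; rewrite !inE.
  have E_gt0 : 0 < #|E| by case: #|E| E8; lia.
  have leF : #|F| <= s by rewrite -[leqRHS]card_ord max_card.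
  have cF : #|~: F| + #|F| = s by rewrite addnC cardsC card_ord.
  have h := expn_codensity_le g_gt0 cF Fg.
  have {}h : 2 ^ 17 * #|~: F| ^ m <= s ^ m.
    by rewrite /m [17 * g]mulnC !expnM -expnMn leq_exp2r.
  have {}h : (2 ^ 17) ^ #|E| * (#|~: F| ^ m) ^ #|E| <= (s ^ m) ^ #|E|.
    by rewrite -expnMn leq_exp2r.
  have -> : s ^ (s * m) = (s ^ m) ^ #|E| * (s ^ m) ^ (s - #|E|).
    by rewrite -expnD subnKC // mulnC expnM.
  rewrite mulnA leq_mul2r; apply/orP; right; apply: leq_trans h.
  rewrite leq_mul2r; apply/orP; right.
  (* The exponents compare because [2 * s <= 16 * #|E|]; the seventeenth [#|E|], being positive,
     pays for the factor 2 that makes the union bound strict. *)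
  have -> : 4 ^ s = 2 ^ (2 * s) by rewrite expnM.
  rewrite -expnM -expnS leq_exp2l //.
  by move: E8 E_gt0; move: #|E|; clear; lia.
case: (pickP [pred h : {ffun 'I_s * 'I_m -> 'I_s} |
  [forall p, big p ==> (h \notin family (fam p.1 p.2))]]).
  move=> h /forallP hP; exists h => E F E8 Fg.
  have := hP (E, F); rewrite /big /= E8 Fg /=.
  case: (boolP [exists i in E, exists l, h (i, l) \in F]).
    by move=> /exists_inP[i iE /existsP]; exists i.
  move=> nh.
  case/negP; apply/familyP => -[i l]; rewrite /fam /=.
  case: ifP => // iE; rewrite inE; apply: contra nh => hF.
  by apply/exists_inP; exists i => //; apply/existsP; exists l.
move=> noh; exfalso.
have : s ^ (s * m) <= \sum_(p | big p) #|family (fam p.1 p.2)|.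
  have -> : s ^ (s * m) = #|{: {ffun 'I_s * 'I_m -> 'I_s}}|.
    by rewrite card_ffun card_prod !card_ord.
  rewrite -sum1_card.
  under [leqRHS]eq_bigr => p _ do rewrite -sum1_card.
  rewrite (exchange_big_dep predT) //=; apply: leq_sum => h _.
  have /negbT := noh h; rewrite /= negb_forall => /existsP[p].
  rewrite negb_imply negbK => /andP[bp hp].
  by rewrite (bigD1 p) ?bp //= leq_addr.
have : 2 * 4 ^ s * \sum_(p | big p) #|family (fam p.1 p.2)| <= 4 ^ s * s ^ (s * m).
  rewrite big_distrr /=; apply: (@leq_trans (\sum_(p : {set 'I_s} * {set 'I_s}) s ^ (s * m))).
    rewrite [leqRHS](bigID big) /=; apply: leq_trans (leq_addr _ _).
    by apply: leq_sum => -[E F] /card_fam.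
  rewrite sum_nat_const card_prod /= -!cardsT -powersetT card_powerset cardsT card_ord.
  by rewrite -expnMn.
have : 0 < s ^ (s * m) by rewrite expn_gt0 s_gt0.
have : 0 < 4 ^ s by rewrite expn_gt0.
nia.
Qed.

Lemma expander g s : 0 < g -> 0 < s ->
  exists h : nat -> seq nat,
    [/\ forall i, size (h i) <= 17 * g, forall i w, w \in h i -> w < s
      & forall E F : {set 'I_s}, s <= 8 * #|E| -> s <= g * #|F| ->
          exists i j : 'I_s, [/\ i \in E, j \in F & (j : nat) \in h i]].
Proof.
move=> g_gt0 s_gt0; have [f fP] := expander_ffun g_gt0 s_gt0.
exists (fun i => if insub i is Some o
                 then [seq (f (o, l) : nat) | l <- enum 'I_(17 * g)] else [::]).
split=> [i|i w|E F E8 Fg].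
- by case: insub => // o; rewrite size_map size_enum_ord.
- by case: insub => // o /mapP[l _ ->].
have [i iE [l lF]] := fP E F E8 Fg; exists i, (f (i, l)); split=> //.
by rewrite valK; apply/mapP; exists l; rewrite ?mem_enum.
Qed.

(** * A depth-robust graph *)

(** A path is encoded as a set in which every vertex but [z] has a predecessor, the form in which
    the adversary declares its vertices false. When [D] is decreasing, following predecessors inside
    [P] from [u] ends at [z]. *)
Definition link (D : nat -> seq nat) (Q : seq nat) (u z : nat) : Prop :=
  exists P : pred nat, [/\ P u, P z, forall y, P y -> y \notin Q
    & forall y, P y -> y != z -> exists2 w, w \in D y & P w].

Lemma link_refl D Q u : u \notin Q -> link D Q u u.
Proof.
by move=> uQ; exists (pred1 u); split=> /= [||y /eqP->|y /eqP-> /eqP] //; exact: eqxx.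
Qed.

Lemma link_edge D Q u z : u \notin Q -> z \notin Q -> z \in D u -> link D Q u z.
Proof.
move=> uQ zQ zD; exists (pred2 u z); split=> /=; rewrite ?eqxx ?orbT //.
- by move=> y /orP[] /eqP->.
- by move=> y /orP[/eqP-> _|/eqP->]; [exists z; rewrite ?eqxx ?orbT|rewrite eqxx].
Qed.

(** The union of the two sets works: vertices of the second keep their predecessors there, and all
    others differ from [y]. *)
Lemma link_trans D Q u y z : link D Q u y -> link D Q y z -> link D Q u z.
Proof.
move=> [P [Pu Py PQ PD]] [P' [Py' Pz' PQ' PD']].
exists (predU P P'); split=> /=; rewrite ?Pu ?Pz' ?orbT //.
  by move=> x /orP[/PQ|/PQ'].
move=> x Px xz; have [P'x|P'x] := boolP (P' x).
  by have [w wD Pw] := PD' x P'x xz; exists w; rewrite //= Pw orbT.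
have {}Px : P x by case/orP: Px => //; rewrite (negbTE P'x).
have xy : x != y by apply: contraNneq P'x => ->.
by have [w wD Pw] := PD x Px xy; exists w; rewrite //= Pw.
Qed.

Lemma link_avoid D Q u z : link D Q u z -> (u \notin Q) * (z \notin Q).
Proof. by move=> [P [Pu Pz PQ _]]; rewrite !PQ. Qed.

Definition block_count (P : pred nat) (j a : nat) : nat :=
  count P (iota (a * 2 ^ j) (2 ^ j)).

Lemma block_count_card (P : pred nat) j a :
  #|[set i : 'I_(2 ^ j) | P (a * 2 ^ j + i)]| = block_count P j a.
Proof.
rewrite cardE /enum_mem size_filter -enumT /block_count -[a * _ in RHS]addn0.
rewrite iotaDl count_map -val_enum_ord count_map.
by apply: eq_count => i /=; rewrite inE.
Qed.

Lemma block_count0 P a : block_count P 0 a = P a.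
Proof. by rewrite /block_count expn0 muln1 /= addn0. Qed.

Lemma block_countS P j a :
  block_count P j.+1 a = block_count P j a.*2 + block_count P j a.*2.+1.
Proof.
rewrite /block_count expnS mul2n -addnn iotaD count_cat.
by congr (count _ (iota _ _) + count _ (iota _ _)); lia.
Qed.

Lemma block_count_meet P P' j a :
  3 * 2 ^ j < 4 * block_count P j a -> 3 * 2 ^ j < 4 * block_count P' j a ->
  exists2 y, P y & P' y.
Proof.
move=> hP hP'; have /hasP[y _ /andP[Py P'y]] : has (predI P P') (iota (a * 2 ^ j) (2 ^ j)).
  rewrite has_count; have := count_predUI P P' (iota (a * 2 ^ j) (2 ^ j)).
  have := count_size (predU P P') (iota (a * 2 ^ j) (2 ^ j)); rewrite size_iota.
  rewrite /block_count in hP hP'; lia.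
by exists y.
Qed.

(** For [k > 0], scale 0 forces an edge from each vertex to the one just below it, which starts the
    inductions on the scale. *)
Definition block_expanding (D : nat -> seq nat) (k : nat) : Prop :=
  forall j a (E F : {set 'I_(2 ^ j)}), j < k ->
    2 ^ j <= 8 * #|E| -> 2 ^ j <= 8 * #|F| ->
    exists i i' : 'I_(2 ^ j),
      [/\ i \in E, i' \in F & a * 2 ^ j + i' \in D (a.+1 * 2 ^ j + i)].

Lemma block_expanding_count D k (P P' : pred nat) j a : block_expanding D k ->
  j < k -> 2 ^ j <= 8 * block_count P j a.+1 -> 2 ^ j <= 8 * block_count P' j a ->
  exists u z, [/\ P u, P' z & z \in D u].
Proof.
move=> DE jk; rewrite -!block_count_card => hP hP'.
have [i [j0 []]] := DE j a [set i : 'I_(2 ^ j) | P (a.+1 * 2 ^ j + i)]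
  [set i : 'I_(2 ^ j) | P' (a * 2 ^ j + i)] jk hP hP'; rewrite !inE => Pi Pi' iD.
by exists (a.+1 * 2 ^ j + i), (a * 2 ^ j + j0).
Qed.

Lemma block_count_compl (P P' : pred nat) j a :
  2 ^ j <= block_count P j a + block_count P' j a
    + block_count (fun y => ~~ P y && ~~ P' y) j a.
Proof.
rewrite /block_count; set s := iota _ _.
rewrite -{1}(size_iota (a * 2 ^ j) (2 ^ j)) -/s.
by elim: s => //= y s; case: (P y); case: (P' y) => /=; lia.
Qed.

(* The expander misses less than 1/8 of the next block and Q meets at most 1/8 of
   it, so that more than 3/4 of it remains reachable. *)
Lemma forward_step D k (Q : seq nat) u j a : block_expanding D k -> j < k ->
  8 * block_count (mem Q) j a <= 2 ^ j ->
  let R := fun z => `[< link D Q u z >] in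
  3 * 2 ^ j < 4 * block_count R j a.+1 -> 3 * 2 ^ j < 4 * block_count R j a.
Proof.
move=> DE jk lightQ R fullR.
have := block_count_compl R (mem Q) j a.
set c := block_count (fun y => _ && _) _ _ => hc.
suff : 8 * c < 2 ^ j by lia.
rewrite ltnNge; apply/negP => c8.
have R8 : 2 ^ j <= 8 * block_count R j a.+1 by lia.
have [y [z [/asboolP uy /andP[/asboolP nz zQ] zD]]] :=
  block_expanding_count DE jk R8 c8.
by apply: nz; apply: (link_trans uy (link_edge _ zQ zD)); rewrite (link_avoid uy).
Qed.

(** The same count as in [forward_step], with reachability of [z] spreading upwards, against the
    edges. *)
Lemma backward_step D k (Q : seq nat) z j a : block_expanding D k -> j < k ->
  8 * block_count (mem Q) j a.+1 <= 2 ^ j ->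
  let R := fun u => `[< link D Q u z >] in
  3 * 2 ^ j < 4 * block_count R j a -> 3 * 2 ^ j < 4 * block_count R j a.+1.
Proof.
move=> DE jk lightQ R fullR.
have := block_count_compl R (mem Q) j a.+1.
set c := block_count (fun y => _ && _) _ _ => hc.
suff : 8 * c < 2 ^ j by lia.
rewrite ltnNge; apply/negP => c8.
have R8 : 2 ^ j <= 8 * block_count R j a by lia.
have [u [y [/andP[/asboolP nu uQ] /asboolP yz yD]]] :=
  block_expanding_count DE jk c8 R8.
by apply: nu; apply: (link_trans (link_edge uQ _ yD) yz); rewrite (link_avoid yz).
Qed.

(** Radius 3 suffices to pass between scales: the two halves of a block adjacent to that of [v] at
    scale [j + 1] lie at most three blocks from that of [v] at scale [j]. *)
Definition near_blocks (j v q : nat) : bool :=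
  (q %/ 2 ^ j <= v %/ 2 ^ j + 3) && (v %/ 2 ^ j <= q %/ 2 ^ j + 3).
Definition light (Q : seq nat) (v j : nat) : bool :=
  8 * count (near_blocks j v) Q <= 2 ^ j.
Definition good (k : nat) (Q : seq nat) (v : nat) : bool :=
  all (light Q v) (iota 0 k).

Lemma light_block Q v j b : light Q v j -> b <= v %/ 2 ^ j + 3 ->
  v %/ 2 ^ j <= b + 3 -> 8 * block_count (mem Q) j b <= 2 ^ j.
Proof.
move=> lQ bv vb; apply: leq_trans lQ; rewrite leq_mul2l /=.
rewrite /block_count -!size_filter; apply: uniq_leq_size.
  by rewrite filter_uniq ?iota_uniq.
move=> q; rewrite !mem_filter mem_iota => /andP[/= qQ /andP[bq qb]].
have -> : near_blocks j v q.
  have -> : q = b * 2 ^ j + (q - b * 2 ^ j) by lia.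
  rewrite /near_blocks divnMDl ?expn_gt0 // divn_small ?addn0 ?bv ?vb //; lia.
by [].
Qed.

Lemma goodP k Q v j : good k Q v -> j < k -> light Q v j.
Proof. by move=> /allP g jk; apply: g; rewrite mem_iota. Qed.

(** At scale 0 lightness reads [8 * count <= 1], so no element of [Q] is within distance 3 of
    [v]. *)
Lemma good_near_notin k Q v w :
  0 < k -> good k Q v -> w <= v + 3 -> v <= w + 3 -> w \notin Q.
Proof.
move=> k0 /goodP /(_ k0) lv wv vw; have := light_block lv (b := w).
by rewrite !divn1 block_count0 /= => /(_ wv vw); case: (w \in Q).
Qed.

Lemma good_notin k Q v : 0 < k -> good k Q v -> v \notin Q.
Proof. by move=> k0 /good_near_notin; apply=> //; rewrite leq_addr. Qed.

(** Induction on the scale. If [a] is the block of [u] at scale [j], the preceding block at scale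
    [j + 1] consists of blocks [a - 2] and [a - 1] for even [a], of [a - 3] and [a - 2] for odd [a].
    All of them are reached from [a - 1] by [forward_step]. *)
Lemma forward_full D k Q u j : block_expanding D k -> good k Q u ->
  j < k -> 0 < u %/ 2 ^ j ->
  3 * 2 ^ j < 4 * block_count (fun z => `[< link D Q u z >]) j (u %/ 2 ^ j).-1.
Proof.
move=> DE gu; elim: j => [|j IH] jk.
  rewrite divn1 => u0.
  rewrite block_count0.
  have -> : `[< link D Q u u.-1 >]; last by [].
  apply/asboolP; apply: link_edge.
  - exact: good_notin gu.
  - by apply: (good_near_notin jk gu); lia.
  - have [] := @block_expanding_count D k (pred1 u) (pred1 u.-1) 0 u.-1 DE jk.
    + by rewrite block_count0 /= prednK ?eqxx.
    + by rewrite block_count0 /= eqxx.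
    + by move=> _ [_ [/eqP-> /eqP-> ]].
have jk' : j < k by lia.
set a := u %/ 2 ^ j.
have aE : u %/ 2 ^ j.+1 = a./2 by rewrite expnSr divnMA divn2.
rewrite aE => a0.
have a2 : 2 <= a by rewrite -(odd_double_half a); lia.
have lQ := light_block (goodP gu jk').
have h1 : 3 * 2 ^ j < 4 * block_count (fun z => `[< link D Q u z >]) j a.-1.
  by apply: IH; rewrite // -/a; lia.
have h2 : 3 * 2 ^ j < 4 * block_count (fun z => `[< link D Q u z >]) j a.-2.
  by apply: (forward_step DE jk'); [apply: lQ; rewrite -/a; lia|rewrite prednK //; lia].
have h3 : 2 < a -> 3 * 2 ^ j < 4 * block_count (fun z => `[< link D Q u z >]) j a.-2.-1.
  move=> a3.
  by apply: (forward_step DE jk'); [apply: lQ; rewrite -/a; lia|rewrite prednK //; lia].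
rewrite block_countS expnS.
have [oa|ea] := boolP (odd a).
  have -> : a./2.-1.*2 = a.-2.-1 by move: (odd_double_half a); rewrite oa; lia.
  have -> : (a.-2.-1).+1 = a.-2 by lia.
  have := h3; lia.
have -> : a./2.-1.*2 = a.-2 by move: (odd_double_half a); rewrite (negbTE ea); lia.
have -> : a.-2.+1 = a.-1 by lia.
lia.
Qed.

(** Upward counterpart of [forward_full]: the next block at scale [j + 1] consists of blocks [a + 2]
    and [a + 3] for even [a], of [a + 1] and [a + 2] for odd [a]. *)
Lemma backward_full D k Q z j : block_expanding D k -> good k Q z -> j < k ->
  3 * 2 ^ j < 4 * block_count (fun u => `[< link D Q u z >]) j (z %/ 2 ^ j).+1.
Proof.
move=> DE gz; elim: j => [|j IH] jk.
  rewrite divn1 block_count0.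
  have -> : `[< link D Q z.+1 z >]; last by [].
  apply/asboolP; apply: link_edge.
  - by apply: (good_near_notin jk gz); lia.
  - exact: good_notin gz.
  - have [] := @block_expanding_count D k (pred1 z.+1) (pred1 z) 0 z DE jk.
    + by rewrite block_count0 /= eqxx.
    + by rewrite block_count0 /= eqxx.
    + by move=> _ [_ [/eqP-> /eqP-> ]].
have jk' : j < k by lia.
set a := z %/ 2 ^ j.
have aE : z %/ 2 ^ j.+1 = a./2 by rewrite expnSr divnMA divn2.
rewrite aE.
have lQ := light_block (goodP gz jk').
have h1 : 3 * 2 ^ j < 4 * block_count (fun u => `[< link D Q u z >]) j a.+1.
  by apply: IH.
have h2 : 3 * 2 ^ j < 4 * block_count (fun u => `[< link D Q u z >]) j a.+2.
  by apply: (backward_step DE jk') => //; apply: lQ; rewrite -/a; lia.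
have h3 : 3 * 2 ^ j < 4 * block_count (fun u => `[< link D Q u z >]) j a.+3.
  by apply: (backward_step DE jk') => //; apply: lQ; rewrite -/a; lia.
rewrite block_countS expnS.
have [oa|ea] := boolP (odd a).
  have -> : (a./2).+1.*2 = a.+1 by move: (odd_double_half a); rewrite oa; lia.
  lia.
have -> : (a./2).+1.*2 = a.+2 by move: (odd_double_half a); rewrite (negbTE ea); lia.
lia.
Qed.

(** Descend from scale [k], where both vertices lie in block 0, to the first scale at which their
    blocks are no longer equal or adjacent. There they are two or three blocks apart, so the dense
    sets reachable from [u] and leading to [z] can be compared in one block. *)
Lemma good_link D k Q u z : block_expanding D k -> 0 < k ->
  good k Q u -> good k Q z -> z <= u -> u < 2 ^ k -> link D Q u z.
Proof.
move=> DE k0 gu gz zu uN.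
have H j : j <= k -> u %/ 2 ^ j <= z %/ 2 ^ j + 1 -> link D Q u z.
  elim: j => [_|j IH jk].
    rewrite !divn1 => uz; have [->|neq] := eqVneq u z.
      by apply: link_refl; apply: good_notin gz.
    have uE : u = z.+1 by lia.
    apply: link_edge; [exact: good_notin gu|exact: good_notin gz|].
    have [] := @block_expanding_count D k (pred1 z.+1) (pred1 z) 0 z DE k0.
    + by rewrite block_count0 /= eqxx.
    + by rewrite block_count0 /= eqxx.
    + by move=> _ [_ [/eqP-> /eqP-> ]]; rewrite uE.
  rewrite expnSr !divnMA => uz.
  have [/IH|far] := leqP (u %/ 2 ^ j) (z %/ 2 ^ j + 1); first by apply; lia.
  have fu := forward_full DE gu jk; have bz := backward_full DE gz jk.
  have lQ := light_block (goodP gu jk).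
  have := @forward_step D k Q u j (z %/ 2 ^ j).+1 DE jk.
  move: fu bz lQ far uz; set a := u %/ _; set b := z %/ _ => fu bz lQ far uz fs.
  have {}fu := fu (ltnW (leq_ltn_trans (leq_addl _ _) far)).
  have [y /asboolP uy /asboolP yz] : exists2 y, `[< link D Q u y >] & `[< link D Q y z >].
    apply: block_count_meet bz.
    (* At distance three one more [forward_step] brings the set reachable from [u] into block
       [b + 1]. *)
    have [ab|ab] : a.-1 = b.+1 \/ a.-1 = b.+2 by lia.
      by rewrite -ab.
    by apply: fs; [apply: lQ; lia|rewrite -ab].
  exact: link_trans uy yz.
apply: (H k) => //.
by rewrite !divn_small //; lia.
Qed.

(** * Few vertices are bad *)

Lemma count_near_blocks j q n :
  count (near_blocks j ^~ q) (iota 0 n) <= 7 * 2 ^ j.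
Proof.
rewrite -size_filter -(size_iota ((q %/ 2 ^ j - 3) * 2 ^ j) (7 * 2 ^ j)).
apply: uniq_leq_size; first by rewrite filter_uniq ?iota_uniq.
move=> v; rewrite mem_filter !mem_iota => /andP[/andP[qv vq] _].
have := leq_trunc_div v (2 ^ j); have := ltn_ceil v (expn_gt0 2 j).
move: qv vq; set x := _ %/ _; set y := v %/ _; set p := 2 ^ j => qv vq h1 h2.
by nia.
Qed.

Lemma sum_count_exchange (r : nat -> nat -> bool) s t :
  \sum_(v <- s) count (r v) t = \sum_(q <- t) count (r^~ q) s.
Proof.
under eq_bigr => v _ do rewrite -sum1_count big_mkcond.
by rewrite exchange_big; apply: eq_bigr => q _; rewrite -sum1_count [RHS]big_mkcond.
Qed.

(** Double counting of near pairs: a heavy vertex is near more than [2 ^ j / 8] elements of [Q], and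
    each element is near at most [7 * 2 ^ j] vertices. *)
Lemma count_heavy j Q n :
  count (fun v => ~~ light Q v j) (iota 0 n) <= 56 * size Q.
Proof.
have p_gt0 : 0 < 2 ^ j by rewrite expn_gt0.
rewrite -(leq_pmul2l p_gt0).
apply: (@leq_trans (\sum_(v <- iota 0 n) 8 * count (near_blocks j v) Q)).
  rewrite -sum1_count big_distrr /= muln1 big_mkcond; apply: leq_sum => v _.
  by case: ifP => //; rewrite /light -ltnNge => /ltnW.
rewrite -big_distrr /= sum_count_exchange.
apply: (@leq_trans (8 * (\sum_(q <- Q) 7 * 2 ^ j))).
  by rewrite leq_mul2l /=; apply: leq_sum => q _; apply: count_near_blocks.
by rewrite big_const_seq count_predT iter_addn_0; nia.
Qed.

Lemma goodS k Q v : good k.+1 Q v = good k Q v && light Q v k.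
Proof. by rewrite /good -addn1 iotaD all_cat /= andbT. Qed.

Lemma count_bad k Q n :
  count (fun v => ~~ good k Q v) (iota 0 n) <= 56 * k * size Q.
Proof.
elim: k => [|k IH]; first by rewrite (eq_count (a2 := pred0)) ?count_pred0.
have := count_predUI (fun v => ~~ good k Q v) (fun v => ~~ light Q v k) (iota 0 n).
have := count_heavy k Q n.
rewrite (eq_count (a1 := fun v => ~~ good k.+1 Q v)
  (a2 := predU (fun v => ~~ good k Q v) (fun v => ~~ light Q v k))); last first.
  by move=> v; rewrite goodS negb_and.
nia.
Qed.

(** * The adversary *)

Lemma good_cons k Q x v : good k (x :: Q) v -> good k Q v.
Proof.
move=> /allP h; apply/allP => j /h; apply: leq_trans.
by rewrite leq_mul2l /= leq_addl.
Qed.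

(** [P] is the set of false vertices, of which only the values on [Q] are committed. At most the
    implication at [u] is violated. Maximality of [u] ensures that every vertex that is good later
    lies below it, as [good_link] leads downwards only. *)
Definition adversary_state (D : nat -> seq nat) (k : nat) (Q : seq nat)
    (P : pred nat) : Prop :=
  exists u, [/\ u < 2 ^ k, good k Q u,
    forall z, z < 2 ^ k -> good k Q z -> z <= u,
    P u /\ P (2 ^ k).-1
    & forall y, P y -> y != u -> exists2 w, w \in D y & P w].

Lemma adversary_init D k : adversary_state D k [::] (pred1 (2 ^ k).-1).
Proof.
have p_gt0 : 0 < 2 ^ k by rewrite expn_gt0.
exists (2 ^ k).-1; split=> //=.
- by rewrite prednK.
- by apply/allP => j _; rewrite /light /= muln0.
- by move=> z zN _; rewrite -ltnS prednK.
- by move=> y ->.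
Qed.

(** Adding a link from [u] to [z] to the false set moves the possible violation to [z]; the link
    avoids [Q], so no answer changes. *)
Lemma adversary_move D k Q P z : block_expanding D k -> 0 < k ->
  adversary_state D k Q P -> z < 2 ^ k -> good k Q z ->
  exists P' : pred nat, [/\ {in Q, P' =1 P}, P' z, P' (2 ^ k).-1
    & forall y, P' y -> y != z -> exists2 w, w \in D y & P' w].
Proof.
move=> DE k0 [u [uN gu maxu [Pu Pt] PD]] zN gz.
have [L [Lu Lz LQ LD]] := good_link DE k0 gu gz (maxu z zN gz) uN.
exists (predU P L); split=> [q qQ|||y] /=.
- by case Lq : (L q) => //=; [have := LQ q Lq; rewrite qQ|rewrite orbF].
- by rewrite Lz orbT.
- by rewrite Pt.
move=> Py yz; have [Ly|Ly] := boolP (L y).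
  by have [w wD Lw] := LD y Ly yz; exists w; rewrite //= Lw orbT.
have {}Py : P y by case/orP: Py => //; rewrite (negbTE Ly).
have yu : y != u by apply: contraNneq Ly => ->.
by have [w wD Pw] := PD y Py yu; exists w; rewrite //= Pw.
Qed.

(** As [112 = 2 * 56], at most half of the vertices are bad for [x :: Q]. The adversary first moves
    to the largest good one and then reads the answer to [x] off the new set. *)
Lemma adversary_query D k Q P x : block_expanding D k -> 0 < k ->
  112 * k * size (x :: Q) <= 2 ^ k -> adversary_state D k Q P ->
  exists2 P' : pred nat, {in Q, P' =1 P} & adversary_state D k (x :: Q) P'.
Proof.
move=> DE k0 sQ st.
pose a z := (z < 2 ^ k) && good k (x :: Q) z.
have exg : exists z, a z.
  have : has (good k (x :: Q)) (iota 0 (2 ^ k)).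
    rewrite has_count; have := count_bad k (x :: Q) (2 ^ k).
    have := count_predC (good k (x :: Q)) (iota 0 (2 ^ k)); rewrite size_iota.
    have : 0 < 2 ^ k by rewrite expn_gt0.
    rewrite [count (predC _) _](eq_count (a2 := fun v => ~~ good k (x :: Q) v)) //.
    by move: (count _ _) (count _ _) => c c'; nia.
  by case/hasP => z; rewrite mem_iota => /andP[_ zN] gz; exists z; rewrite /a zN.
have [u /andP[uN gu] maxu] := ex_maxnP exg (fun z (az : a z) => ltnW (andP az).1).
have [P' [P'Q P'u P't P'D]] := adversary_move DE k0 st uN (good_cons gu).
exists P' => //; exists u; split=> // z zN gz; apply: maxu; exact/andP.
Qed.

(** At most half of the vertices are bad and fewer than half lie in [E], so the violation can be
    placed at a good vertex outside [E]. *)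
Lemma adversary_final D k Q P (E : pred nat) : block_expanding D k -> 0 < k ->
  112 * k * size Q <= 2 ^ k -> adversary_state D k Q P ->
  2 * count E (iota 0 (2 ^ k)) < 2 ^ k ->
  exists (P' : pred nat) z, [/\ {in Q, P' =1 P}, ~~ E z, z \notin Q, P' (2 ^ k).-1
    & forall y, P' y -> y != z -> exists2 w, w \in D y & P' w].
Proof.
move=> DE k0 sQ st sE.
have : has (predI (good k Q) (predC E)) (iota 0 (2 ^ k)).
  rewrite has_count; have := count_bad k Q (2 ^ k).
  have := count_size (predU (good k Q) (predC E)) (iota 0 (2 ^ k)); rewrite size_iota.
  have := count_predUI (good k Q) (predC E) (iota 0 (2 ^ k)).
  have := count_predC (good k Q) (iota 0 (2 ^ k)).
  have := count_predC E (iota 0 (2 ^ k)); rewrite size_iota.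
  rewrite [count (fun v => ~~ good k Q v) _](eq_count (a2 := predC (good k Q))) //.
  nia.
case/hasP => z; rewrite mem_iota => /andP[_ zN] /andP[/= gz Ez].
have [P' [P'Q P'z P't P'D]] := adversary_move DE k0 st zN gz.
by exists P', z; split=> //; exact: good_notin gz.
Qed.

(** * Regular refutations *)

Lemma clause_varsP x (C : clause) :
  reflect (exists2 l, l \in C & x = l.1) (x \in clause_vars C).
Proof. by apply: (iffP (imfsetP _ _ _ _)) => -[l lC xl]; exists l. Qed.

Lemma card_clause_vars C : #|` clause_vars C| <= width C.
Proof. exact: leq_imfset_card. Qed.

(** Otherwise [j] followed by [c] up to its first clause containing [x] is an irregularity; it has
    at least three entries because the head of [c] lacks [x]. *)
Lemma regular_forgotten p c j x : regular p ->
  sorted (premiss_of p) (j :: c) ->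
  x \notin clause_vars (clause_at p (head 0 c)) ->
  (exists2 i, i \in c & x \in clause_vars (clause_at p i)) ->
  x \notin clause_vars (clause_at p j).
Proof.
move=> reg srt xhd [i ic xi]; apply/negP => xj; apply: reg.
pose a i := x \in clause_vars (clause_at p i).
have ha : has a c by apply/hasP; exists i.
have m_gt0 : 0 < find a c by case: c ic xhd {srt ha} => //= i0 c _; rewrite -/(a i0) => /negbTE->.
have mc := ha; rewrite has_find in mc.
have szs : size (take (find a c).+2 (j :: c)) = (find a c).+2.
  by rewrite size_take /=; case: ifP => //; lia.
exists (take (find a c).+2 (j :: c)); split.
- by rewrite szs; lia.
- exact: take_sorted.
exists x; rewrite szs; split => //.
- have -> : last 0 (take (find a c).+2 (j :: c)) = nth 0 c (find a c).
    by rewrite -nth_last szs nth_take.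
  exact: (nth_find 0 ha).
- move=> m /andP[m0 mf]; rewrite nth_take; last by lia.
  case: m m0 mf => // m _ mf /=; apply/negbT.
  by apply: (before_find 0 (a := a)); lia.
Qed.

(** [A] stands for being falsified. It is left abstract to cover both a total assignment and one
    defined on the queried variables only. *)
Lemma premiss_falsified S p i y j l (A : pred literal) : valid_line S p i ->
  just (nth line0 p i) = Resolve y j l ->
  (forall u, u \in clause_at p i -> A u) -> A (y, true) || A (y, false) ->
  exists m, [/\ m < i, premiss_of p m i, y \in clause_vars (clause_at p m)
    & forall u, u \in clause_at p m -> A u].
Proof.
rewrite /valid_line => + jE; rewrite jE => -[ji li yj yl ->] AC /orP[]Ay.
- exists j; split=> //; first by rewrite /premiss_of /premisses jE mem_head.
  + by apply/clause_varsP; exists (y, true).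
  + move=> u uj; have [->//|uy] := eqVneq u (y, true).
    by apply: AC; rewrite !inE uy uj.
- exists l; split=> //; first by rewrite /premiss_of /premisses jE !inE eqxx orbT.
  + by apply/clause_varsP; exists (y, false).
  + move=> u ul; have [->//|uy] := eqVneq u (y, false).
    by apply: AC; rewrite !inE uy ul orbT.
Qed.

(** Follow falsified premisses upwards, with [c] recording the positions already passed. By
    [regular_forgotten], a variable lost from the current clause stays absent at each step. *)
Lemma walk_to_initial S p (P : pred nat) i c : regular p ->
  (forall i, i < size p -> valid_line S p i) -> i < size p ->
  sorted (premiss_of p) (i :: c) ->
  (forall l, l \in clause_at p i -> P l.1 == l.2) ->
  exists2 C, C \in S & (forall l, l \in C -> P l.1 == l.2) /\
    forall x, x \notin clause_vars (clause_at p i) ->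
      (exists2 m, m \in i :: c & x \in clause_vars (clause_at p m)) ->
      x \notin clause_vars C.
Proof.
move=> reg valid; elim/ltn_ind: i c => i IH c ip srt fals.
have vi := valid i ip.
case jE : (just (nth line0 p i)) => [|y j l].
  by move: vi; rewrite /valid_line jE => iS; exists (clause_at p i).
have [||m [mi pmi _ mA]] := premiss_falsified (A := fun l => P l.1 == l.2) vi jE.
- exact: fals.
- by rewrite /=; case: (P y).
have [||C CS [CA Cx]] := IH m mi (i :: c) _ _ mA.
- exact: ltn_trans ip.
- by rewrite /= pmi.
exists C => //; split=> // x xi xc; apply: Cx; last first.
  by case: xc => n nc xn; exists n; rewrite // in_cons nc orbT.
by apply: (regular_forgotten reg (c := i :: c)) => //=; rewrite pmi.
Qed.

Lemma line_vars S p : (forall i, i < size p -> valid_line S p i) ->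
  forall i, i < size p -> {subset clause_vars (clause_at p i) <= vars S}.
Proof.
move=> valid; elim/ltn_ind=> i IH ip x; have := valid i ip; rewrite /valid_line.
case: (just _) => [iS /clause_varsP[l li ->]|y j l [ji li _ _ ->]].
  by apply/imfset2P; exists (clause_at p i) => //; exists l.
case/clause_varsP => u; rewrite !inE => /orP[]/andP[_ uj] ->.
- by apply: (IH j ji (ltn_trans ji ip)); apply/clause_varsP; exists u.
- by apply: (IH l li (ltn_trans li ip)); apply/clause_varsP; exists u.
Qed.

(* The partial assignment is encoded by its false set: P x means that x is
   false, so that P agrees with l.2 exactly when the literal l is falsified. *)
Lemma regular_width S p D mu k : 0 < k -> block_expanding D k ->
  224 * k <= 2 ^ k ->
  (forall F : seq nat, uniq F -> all (fun x => x < 2 ^ k) F ->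
     2 ^ k <= 448 * k * size F ->
     2 * count (fun v => ~~ has (mem F) (mu v)) (iota 0 (2 ^ k)) < 2 ^ k) ->
  (forall x, x \in vars S -> x < 2 ^ k) ->
  (forall (P : pred nat) C, C \in S -> P (2 ^ k).-1 ->
     (forall l, l \in C -> P l.1 == l.2) ->
     exists v, [/\ v \in clause_vars C, {subset mu v <= clause_vars C},
       P v & forall w, w \in D v -> ~~ P w]) ->

  refutation S p -> regular p ->
  exists2 C, C \in proof_clauses p & 2 ^ k <= 448 * k * width C.
Proof.
move=> k0 DE kbig hits varsS Sspec [p0 valid pend] reg.
apply: contrapT => /forall2NP narrow.
have {}narrow i : i < size p -> 448 * k * width (clause_at p i) < 2 ^ k.
  move=> ip; case: (narrow (clause_at p i)) => [|/negP]; last by rewrite -ltnNge.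
  by case; rewrite /clause_at -(nth_map line0 fset0 concl ip) mem_nth ?size_map.
(* Invariant: [Q] lists queried variables, each occurring in a clause passed so far, and the current
   clause is falsified by the answers on [Q]. *)
have walk i : forall c (Q : seq nat) P, i < size p -> sorted (premiss_of p) (i :: c) ->
    uniq Q -> all (fun x => x < 2 ^ k) Q -> adversary_state D k Q P ->
    (forall q, q \in Q -> exists2 m, m \in i :: c & q \in clause_vars (clause_at p m)) ->
    (forall l, l \in clause_at p i -> (l.1 \in Q) && (P l.1 == l.2)) ->
    112 * k * size Q <= 2 ^ k -> False.
  elim/ltn_ind: i => i IH c Q P ip srt uQ QN st Qc fals sQ.
  have vi := valid i ip.
  (* With [2 ^ k / (224 * k)] queries and a clause narrower than half that number, at least half of
     the threshold is forgotten, as [hits] demands. *)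
  have [long|short] := leqP (2 ^ k) (224 * k * size Q).
    pose F := [seq x <- Q | x \notin clause_vars (clause_at p i)].
    have FN : all (fun x => x < 2 ^ k) F.
      by apply/allP => x; rewrite mem_filter => /andP[_ /(allP QN)].
    have sF : 2 ^ k <= 448 * k * size F.
      have : size Q <= size F + width (clause_at p i).
        rewrite -(count_predC (mem (clause_vars (clause_at p i))) Q) addnC.
        rewrite /F size_filter leq_add2l -size_filter.
        apply: leq_trans (card_clause_vars _).
        apply: uniq_leq_size; first exact: filter_uniq.
        by move=> x; rewrite mem_filter => /andP[].
      by have := narrow i ip; nia.
    have [P' [z [P'Q Ez zQ P't P'D]]] :=
      adversary_final DE k0 sQ st (hits F (filter_uniq _ uQ) FN sF).
    have [l /fals/andP[lQ /eqP <-]|C CS [CA Cx]] :=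
      walk_to_initial (P := P') reg valid ip srt.
      by rewrite P'Q.
    have [v [vC muC Pv Dv]] := Sspec P' C CS P't CA.
    (* [z] is the only false vertex without a false predecessor. *)
    have vz : v = z.
      by apply/eqP; apply: contraT => /P'D-/(_ Pv)[w /Dv/negP].
    (* [mu z] contains a forgotten variable, which regularity keeps out of [C]. *)
    move: Ez; rewrite negbK -vz => /hasP[x xmu /=].
    rewrite mem_filter => /andP[xi /Qc xc].
    by move: (Cx x xi xc); rewrite muC.
  case jE : (just (nth line0 p i)) => [|y j l].
    (* An initial clause met early mentions queried variables only, whereas the violation can still
       be moved to an unqueried vertex. *)
    have : clause_at p i \in S by move: vi; rewrite /valid_line jE.
    have [|P' [z [P'Q _ zQ P't P'D]]] := adversary_final (E := pred0) DE k0 sQ st.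
      by rewrite count_pred0 expn_gt0.
    move=> iS; have [|v [vC _ Pv Dv]] := Sspec P' _ iS P't.
      by move=> l /fals/andP[lQ /eqP <-]; rewrite P'Q.
    have vz : v = z.
      by apply/eqP; apply: contraT => /P'D-/(_ Pv)[w /Dv/negP].
    by case/clause_varsP: vC => l /fals/andP[+ _] vl; rewrite -vl vz (negbTE zQ).
  have [yQ|yQ] := boolP (y \in Q).
    have [|m [mi pmi _ mA]] := premiss_falsified vi jE fals.
      by rewrite /= yQ; case: (P y).
    apply: (IH m mi (i :: c) Q P) => //; first exact: ltn_trans ip.
      by rewrite /= pmi.
    by move=> q /Qc[n nc qn]; exists n; rewrite // in_cons nc orbT.
  (* Half of the budget comes from [short], the other half from [kbig]. *)
  have sQ' : 112 * k * size (y :: Q) <= 2 ^ k by rewrite /=; nia.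
  have [P' P'Q st'] := adversary_query DE k0 sQ' st.
  have [||m [mi pmi ym mA]] := premiss_falsified
    (A := fun l => (l.1 \in y :: Q) && (P' l.1 == l.2)) vi jE.
  - move=> u /fals/andP[xQ uP]; rewrite inE xQ orbT /=.
    by rewrite P'Q.
  - by rewrite /= inE eqxx; case: (P' y).
  have mp := ltn_trans mi ip.
  apply: (IH m mi (i :: c) (y :: Q) P') => //=.
  - by rewrite pmi.
  - by rewrite yQ.
  - by rewrite QN andbT; apply: varsS; apply: (line_vars valid mp).
  - move=> q; rewrite inE => /orP[/eqP->|/Qc[n nc qn]].
      by exists m => //; rewrite mem_head.
    by exists n; rewrite // in_cons nc orbT.
have lastE : clause_at p (size p).-1 = fset0 by rewrite /clause_at nth_last.
apply: (@walk (size p).-1 [::] [::] (pred1 (2 ^ k).-1)) => //.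
- by rewrite prednK.
- exact: adversary_init.
- by move=> l; rewrite lastE inE.
- by rewrite muln0.
Qed.

(** * Regular tree-style refutations from decision trees *)

Definition all_premisses (p : proof) : seq nat :=
  flatten [seq premisses l | l <- p].

(** [L i] plays the role of the set of variables queried on the branch leading to [i]; it grows
    towards the premisses, and every pivot is new. *)
Definition labelling (p : proof) (L : nat -> pred nat) : Prop :=
  forall i, i < size p -> (forall x, x \in clause_vars (clause_at p i) -> L i x) /\
    forall y j l, just (nth line0 p i) = Resolve y j l ->
      ~~ L i y /\ forall m x, m \in [:: j; l] -> L i x || (x == y) -> L m x.

Lemma resolvent_vars x y A B : x != y ->
  x \in clause_vars A \/ x \in clause_vars B -> x \in clause_vars (resolvent y A B).
Proof.
move=> xy [] /clause_varsP[l lA xl]; apply/clause_varsP; exists l => //; rewrite !inE.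
- by rewrite lA andbT; apply/orP; left; apply: contraNneq xy => le; rewrite xl le.
- by rewrite lA andbT; apply/orP; right; apply: contraNneq xy => le; rewrite xl le.
Qed.

Lemma premiss_of_lt p j i : premiss_of p j i -> i < size p.
Proof. by rewrite ltnNge; apply: contraL => ip; rewrite /premiss_of nth_default. Qed.

(** A variable lost between the first two clauses of an irregularity is the pivot there, hence
    outside the label of the second. But its occurrence in the last clause puts it into all labels
    above, including that one. *)
Lemma labelled_regular S p L : (forall i, i < size p -> valid_line S p i) ->
  labelling p L -> regular p.
Proof.
move=> valid lab [s [sz srt [x [xh xl xm]]]].
have mono c m : premiss_of p m c -> forall z, L c z -> L m z.
  move=> pmc; have /lab[_] := premiss_of_lt pmc; move: pmc; rewrite /premiss_of /premisses.
  case: (just _) => // y j l mjl /(_ y j l erefl)[_ h] z Lz.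
  by apply: h; rewrite ?Lz.
case: s sz srt xh xl xm => // c1 [//|c2 [//|c3 s]] _ /= /andP[p12 /andP[p23 srt]] xh xl xm.
have x2 := xm 1 isT; rewrite /= in x2.
have c2p := premiss_of_lt p12.
have L2 : ~~ L c2 x.
  have [_ h] := lab _ c2p; have := valid _ c2p.
  move: p12; rewrite /premiss_of /premisses /valid_line.
  case jE : (just _) => [|y j l] //; rewrite !inE => c1jl [_ _ _ _ cE].
  have [xy|xy] := eqVneq x y; first by have [] := h y j l jE; rewrite xy.
  case/negP: x2; rewrite cE; apply: resolvent_vars => //.
  by case/orP: c1jl => /eqP <-; [left|right].
case/negP: L2; apply: (mono _ _ p23).
have Lend c t : path (premiss_of p) c t -> L (last c t) x -> L c x.
  elim: t c => [//|d t IH] c /= /andP[pcd pt] /(IH _ pt); exact: mono.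
apply: (Lend _ _ srt).
have lastp : last c3 s < size p.
  case/lastP: s srt {xl xm} => [_|s d]; last first.
    by rewrite rcons_path last_rcons => /andP[_ /premiss_of_lt].
  exact: premiss_of_lt p23.
by have [h _] := lab _ lastp; apply: h.
Qed.

(* [rho] lists the answers given on a branch of a decision tree; the clause
   derived at its node is falsified by them. *)
Definition refutable (S : clause_set) (rho : seq literal) (s : nat) : Prop :=
  exists p C, [/\ derivation S p C, size p <= s,
    forall l, l \in C -> (l.1, ~~ l.2) \in rho,
    uniq (all_premisses p) && all (fun j => j < (size p).-1) (all_premisses p)
    & exists2 L, labelling p L
        & forall x, x \in [seq l.1 | l <- rho] -> L (size p).-1 x].

Lemma refutable_leaf (S : clause_set) (rho : seq literal) (C : clause) : C \in S ->
  (forall l, l \in C -> (l.1, ~~ l.2) \in rho) -> refutable S rho 1.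
Proof.
move=> CS Crho; exists [:: Line C Initial], C; split=> //.
  by split=> // -[].
exists (fun _ x => x \in [seq l.1 | l <- rho]) => // -[//|]; split=> // x.
case/clause_varsP => l /Crho lrho ->.
by apply/mapP; exists (l.1, ~~ l.2).
Qed.

Lemma refutable_leq S rho s s' : s <= s' -> refutable S rho s -> refutable S rho s'.
Proof.
move=> ss' [p [C [? ps ? ? ?]]]; exists p, C; split=> //; exact: leq_trans ss'.
Qed.

Definition shift_line (m : nat) (l : line) : line :=
  Line (concl l) (if just l is Resolve y i j then Resolve y (m + i) (m + j) else Initial).

Definition glue (x : nat) (p q : proof) : proof :=
  p ++ rcons [seq shift_line (size p) l | l <- q]
    (Line (resolvent x (concl (last line0 p)) (concl (last line0 q)))
       (Resolve x (size p).-1 (size p + (size q).-1))).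

Lemma size_glue x p q : size (glue x p q) = (size p + size q).+1.
Proof. by rewrite size_cat size_rcons size_map addnS. Qed.

Lemma nth_glue_left x p q i : i < size p -> nth line0 (glue x p q) i = nth line0 p i.
Proof. by move=> ip; rewrite nth_cat ip. Qed.

Lemma nth_glue_right x p q i : i < size q ->
  nth line0 (glue x p q) (size p + i) = shift_line (size p) (nth line0 q i).
Proof.
move=> iq; rewrite nth_cat ltnNge leq_addr /= addKn nth_rcons size_map iq.
by rewrite (nth_map line0).
Qed.

Lemma nth_glue_last x p q : nth line0 (glue x p q) (size p + size q) =
  Line (resolvent x (concl (last line0 p)) (concl (last line0 q)))
       (Resolve x (size p).-1 (size p + (size q).-1)).
Proof. by rewrite nth_cat ltnNge leq_addr /= addKn nth_rcons size_map ltnn eqxx. Qed.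

Lemma glue_cases (p q : proof) i : i < (size p + size q).+1 ->
  [\/ i < size p, exists2 j, j < size q & i = size p + j | i = size p + size q].
Proof.
move=> ipq; have [ip|pi] := ltnP i (size p); first by constructor 1.
have [iq|qi] := ltnP (i - size p) (size q); last by constructor 3; lia.
by constructor 2; exists (i - size p); rewrite // subnKC.
Qed.

Lemma all_premisses_glue x p q : all_premisses (glue x p q) =
  all_premisses p ++ [seq size p + j | j <- all_premisses q] ++
  [:: (size p).-1; size p + (size q).-1].
Proof.
rewrite /all_premisses /glue map_cat flatten_cat map_rcons -cats1 flatten_cat /=.
congr (_ ++ (_ ++ _)); rewrite -map_comp map_flatten -map_comp; congr flatten.
by apply: eq_map => l; rewrite /= /premisses /shift_line /=; case: (just l).
Qed.

(** If the clause of one branch lacks the literal on [x], it already serves [rho] and the other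
    branch is dropped; otherwise the two clauses are resolved on [x]. *)
Lemma refutable_node S (rho : seq literal) x a b :
  x \notin [seq l.1 | l <- rho] ->
  refutable S ((x, false) :: rho) a -> refutable S ((x, true) :: rho) b ->
  refutable S rho (a + b).+1.
Proof.
move=> xrho [p [A [dA pa Arho /andP[up ap] [L labL XL]]]].
move=> [q [B [dB qb Brho /andP[uq aq] [M labM XM]]]].
have Asub l : l \in A -> l != (x, true) -> (l.1, ~~ l.2) \in rho.
  move=> /Arho; rewrite inE => /orP[|//]; case: l => z c /=.
  by rewrite xpair_eqE => /andP[/eqP->]; case: c; rewrite ?eqxx.
have Bsub l : l \in B -> l != (x, false) -> (l.1, ~~ l.2) \in rho.
  move=> /Brho; rewrite inE => /orP[|//]; case: l => z c /=.
  by rewrite xpair_eqE => /andP[/eqP->]; case: c; rewrite ?eqxx.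
have [xA|xA] := boolP ((x, true) \in A); last first.
  exists p, A; split=> //; first by lia.
  - by move=> l lA; apply: Asub => //; apply: contraNneq xA => <-.
  - by rewrite up.
  - by exists L => // z zrho; apply: XL; rewrite inE zrho orbT.
have [xB|xB] := boolP ((x, false) \in B); last first.
  exists q, B; split=> //; first by lia.
  - by move=> l lB; apply: Bsub => //; apply: contraNneq xB => <-.
  - by rewrite uq.
  - by exists M => // z zrho; apply: XM; rewrite inE zrho orbT.
have [p0 vp pA] := dA; have [q0 vq qB] := dB.
have Rsub l : l \in resolvent x A B -> (l.1, ~~ l.2) \in rho.
  by rewrite !inE => /orP[]/andP[? ?]; [apply: Asub|apply: Bsub].
have atl i : i < size p -> clause_at (glue x p q) i = clause_at p i.
  by move=> ip; rewrite /clause_at nth_glue_left.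
have atr i : i < size q -> clause_at (glue x p q) (size p + i) = clause_at q i.
  by move=> iq; rewrite /clause_at nth_glue_right.
have atend : clause_at (glue x p q) (size p + size q) = resolvent x A B.
  by rewrite /clause_at nth_glue_last /= pA qB.
have pAt : clause_at p (size p).-1 = A by rewrite /clause_at nth_last pA.
have qBt : clause_at q (size q).-1 = B by rewrite /clause_at nth_last qB.
have p1 : (size p).-1 < size p by rewrite prednK.
have q1 : (size q).-1 < size q by rewrite prednK.
exists (glue x p q), (resolvent x A B); rewrite !size_glue /=; split=> //.
- split.
  + by rewrite size_glue.
  + rewrite size_glue => i /glue_cases[ip|[j jq ->]|->].
    * rewrite /valid_line nth_glue_left // atl //.
      have := vp i ip; rewrite /valid_line; case: (just _) => // y j l [ji li].
      by rewrite !atl //; lia.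
    * rewrite /valid_line nth_glue_right // atr //=.
      have := vq j jq; rewrite /valid_line; case: (just _) => // y m l [mj lj].
      by rewrite !atr ?ltn_add2l //; lia.
    * rewrite /valid_line nth_glue_last /= atend atl // atr // pAt qBt.
      by split=> //; lia.
  + by rewrite -nth_last size_glue /= -[RHS]atend.
- by lia.
(* The last line of either part is not a premiss inside that part, so the new inference is its first
   use. *)
- rewrite all_premisses_glue !cat_uniq !all_cat all_map up.
  rewrite map_inj_uniq ?uq; last exact: addnI.
  have -> : all (fun j => j < size p + size q) (all_premisses p).
    by apply: sub_all ap => j /=; lia.
  have -> : all (preim (addn (size p)) (fun j => j < size p + size q)) (all_premisses q).
    by apply: sub_all aq => j /=; lia.
  rewrite has_cat /= !inE !orbF !andbT.
  have leq1 j : j \in all_premisses p -> j < (size p).-1 by move=> /(allP ap).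
  have leq2 j : j \in all_premisses q -> j < (size q).-1 by move=> /(allP aq).
  rewrite !negb_or; do ?[apply/andP; split]; try lia.
  + by rewrite has_map; apply/hasPn => j _ /=; apply/negP => /leq1; lia.
  + by apply/negP => /leq1; lia.
  + by apply/negP => /leq1; lia.
  + by apply/negP => /mapP[j /leq2]; lia.
  + by apply/negP => /mapP[j /leq2]; lia.
- exists (fun i => if i < size p then L i else if i < size p + size q then M (i - size p)
      else (fun z => z \in [seq l.1 | l <- rho])); last first.
    by move=> z; rewrite ltnNge leq_addr ltnn.
  move=> i; rewrite size_glue => /glue_cases[ip|[j jq ->]|->].
  + rewrite atl // nth_glue_left // ip; have [h1 h2] := labL i ip; split=> // y j l jE.
    have := vp i ip; rewrite /valid_line jE => -[ji li _ _ _].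
    have [h3 h4] := h2 y j l jE; split=> // m z mjl Lz.
    have -> : m < size p by move: mjl; rewrite !inE => /orP[]/eqP->; lia.
    exact: h4 Lz.
  + rewrite atr // nth_glue_right //.
    rewrite ltnNge leq_addr /= ltn_add2l jq addKn; have [h1 h2] := labM j jq; split=> // y m l.
    rewrite /shift_line /=; case jE : (just _) => [//|y' m' l'] [<- <- <-].
    have := vq j jq; rewrite /valid_line jE => -[ji li _ _ _].
    have [h3 h4] := h2 _ _ _ jE; split=> // n z njl Mz.
    have [n' n'jl ->] : exists2 n', n' \in [:: m'; l'] & n = size p + n'.
      by move: njl; rewrite !inE => /orP[]/eqP->; [exists m'|exists l']; rewrite ?inE ?eqxx ?orbT.
    have -> : size p + n' < size p + size q.
      by move: n'jl; rewrite !inE => /orP[]/eqP->; lia.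
    by rewrite ltnNge leq_addr /= addKn; apply: h4 Mz.
  + rewrite atend nth_glue_last /= [size p + size q < size p]ltnNge leq_addr ltnn /=; split.
      move=> z /clause_varsP[l /Rsub lrho ->].
      by apply/mapP; exists (l.1, ~~ l.2).
    move=> y j l [<- <- <-]; split=> // m z; rewrite !inE => /orP[]/eqP-> zx.
      by rewrite p1; apply: XL; rewrite /= inE orbC.
    rewrite ltnNge leq_addr /= ltn_add2l q1 addKn.
    by apply: XM; rewrite /= inE orbC.
Qed.

Lemma refutable_refutation S s : refutable S [::] s ->
  exists p, [/\ refutation S p, regular p, tree_style p & size p <= s].
Proof.
move=> [p [C [dC ps Crho /andP[up _] [L lab _]]]]; exists p.
have C0 : C = fset0 by apply/fsetP => l; rewrite inE; apply/negP => /Crho.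
rewrite C0 in dC; split=> //.
have [_ valid _] := dC; exact: (labelled_regular valid lab).
Qed.

Lemma refutable_complete_tree S ms (rho : seq literal) : uniq [seq l.1 | l <- rho] ->
  (forall rho', uniq [seq l.1 | l <- rho'] -> {subset rho <= rho'} ->
     {subset ms <= [seq l.1 | l <- rho']} -> refutable S rho' 1) ->
  refutable S rho (2 ^ (size ms).+1).-1.
Proof.
elim: ms rho => [|m ms IH] rho urho leaf; first exact: leaf.
have [mrho|mrho] := boolP (m \in [seq l.1 | l <- rho]).
  apply: (refutable_leq (s := (2 ^ (size ms).+1).-1)).
    by rewrite -!subn1 leq_sub2r // leq_exp2l.
  apply: IH => // rho' u' sub sub'; apply: leaf => // x; rewrite inE => /orP[/eqP->|/sub'//].
  by case/mapP: mrho => l /sub lrho' ->; apply/mapP; exists l.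
have branch b : refutable S ((m, b) :: rho) (2 ^ (size ms).+1).-1.
  apply: IH => [|rho' u' sub sub']; first by rewrite /= mrho.
  apply: leaf => // [l lrho|x]; first by apply: sub; rewrite inE lrho orbT.
  rewrite inE => /orP[/eqP->|/sub'//].
  by apply/mapP; exists (m, b) => //; apply: sub; rewrite mem_head.
apply: refutable_leq (refutable_node mrho (branch false) (branch true)).
have : 0 < 2 ^ (size ms).+1 by rewrite expn_gt0.
rewrite [size (_ :: _)]/= [2 ^ (size ms).+2]expnS; lia.
Qed.

(** * Masked pebbling formulas *)

Lemma in_fset_seq (T : choiceType) (s : seq T) x : (x \in [fset y in s]) = (x \in s).
Proof. by rewrite in_fset. Qed.

Lemma in_fset_sep (T : choiceType) (A : {fset T}) (a : pred T) x :
  (x \in [fset y in A | a y]) = (x \in A) && a x.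
Proof. by rewrite !inE. Qed.

(** [B] is the set of true variables of the falsifying assignment. *)
Definition falsified_clause (W B : {fset nat}) : clause :=
  [fset (x, x \notin B) | x in W].

Definition scope (D mu : nat -> seq nat) (v : nat) : {fset nat} :=
  [fset x in v :: D v ++ mu v].

Lemma mem_scope (D mu : nat -> seq nat) v x :
  (x \in scope D mu v) = [|| x == v, x \in D v | x \in mu v].
Proof. by rewrite in_fset_seq inE mem_cat. Qed.

(** [B] runs over the assignments to the scope that violate the implication from [D v] to [v], with
    all sign patterns on the rest of [mu v]. *)
Definition masked_implications (D mu : nat -> seq nat) (n : nat) : seq clause :=
  flatten [seq [seq falsified_clause (scope D mu v) B
                | B <- fpowerset (scope D mu v) & (v \notin B) && all (mem B) (D v)]
          | v <- iota 0 n].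

Definition masked_formula (D mu : nat -> seq nat) (n : nat) : clause_set :=
  [fset C in [fset (n.-1, false)] :: masked_implications D mu n].

Lemma mem_falsified_clause W B l :
  (l \in falsified_clause W B) = (l.1 \in W) && (l.2 == (l.1 \notin B)).
Proof.
apply/imfsetP/andP => [[x /= xW ->]|[lW /eqP lB]] //=.
by exists l.1; rewrite //= -lB; case: l {lW lB}.
Qed.

Lemma falsified_clause_vars W B : clause_vars (falsified_clause W B) = W.
Proof.
apply/fsetP => x; apply/clause_varsP/idP => [[l]|xW].
  by rewrite mem_falsified_clause => /andP[lW _] ->.
by exists (x, x \notin B); rewrite // mem_falsified_clause xW eqxx.
Qed.

Lemma masked_formulaP D mu n C :
  reflect (C = [fset (n.-1, false)] \/ exists v B, [/\ v < n, B `<=` scope D mu v,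
    v \notin B, {subset D v <= B} & C = falsified_clause (scope D mu v) B])
  (C \in masked_formula D mu n).
Proof.
rewrite in_fset_seq /= inE; apply: (iffP orP) => -[].
- by move=> /eqP; left.
- case/flatten_mapP => v; rewrite mem_iota => /andP[_ vn] /mapP[B].
  rewrite mem_filter => /andP[/andP[vB /allP DB]]; rewrite fpowersetE => BW ->.
  by right; exists v, B.
- by move=> ->; left.
- move=> [v [B [vn BW vB DB ->]]]; right; apply/flatten_mapP; exists v.
    by rewrite mem_iota.
  apply/mapP; exists B => //; rewrite mem_filter fpowersetE BW vB andbT /=.
  exact/allP.
Qed.

Lemma masked_formula_scope (D mu : nat -> seq nat) n v (B : {fset nat}) : v < n -> v \notin B ->
  {subset D v <= B} -> falsified_clause (scope D mu v) B \in masked_formula D mu n.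
Proof.
move=> vn vB DB; apply/masked_formulaP; right; exists v, (scope D mu v `&` B).
split=> //; first exact: fsubsetIl.
- by rewrite inE (negbTE vB) andbF.
- by move=> x xD; rewrite inE mem_scope xD orbT DB.
apply/fsetP => l; rewrite !mem_falsified_clause inE.
by case: (l.1 \in scope D mu v).
Qed.

Lemma card_scope (D mu : nat -> seq nat) v : #|` scope D mu v| <= (size (D v) + size (mu v)).+1.
Proof. by rewrite card_fseq (leq_trans (size_undup _)) //= size_cat. Qed.

Lemma masked_formula_card (D mu : nat -> seq nat) n m : (forall v, #|` scope D mu v| <= m) ->
  #|` masked_formula D mu n| <= (n * 2 ^ m).+1.
Proof.
move=> sW; rewrite card_fseq (leq_trans (size_undup _)) //= ltnS.
rewrite size_flatten /shape -map_comp sumnE big_map.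
apply: (@leq_trans (\sum_(v <- iota 0 n) 2 ^ m)); last first.
  by rewrite big_const_seq count_predT size_iota iter_addn_0 mulnC.
apply: leq_sum => v _; rewrite /= size_map size_filter.
by apply: leq_trans (count_size _ _) _; rewrite card_fpowerset leq_exp2l.
Qed.

Lemma masked_formula_width (D mu : nat -> seq nat) n m C :
  (forall v, #|` scope D mu v| <= m) -> 0 < m ->
  C \in masked_formula D mu n -> width C <= m.
Proof.
move=> sW m0 /masked_formulaP[->|[v [B [_ _ _ _ ->]]]].
  by rewrite /width cardfs1.
by apply: leq_trans (leq_imfset_card _ _ _) _; apply: sW.
Qed.

Lemma masked_formula_vars (D mu : nat -> seq nat) n : 0 < n ->
  (forall v w, w \in D v -> w < v) -> (forall v w, w \in mu v -> w < n) ->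
  vars (masked_formula D mu n) = [fset x in iota 0 n].
Proof.
move=> n0 Dlt mult; apply/fsetP => x; rewrite in_fset_seq mem_iota /=.
apply/imfset2P/idP => [[C /= /masked_formulaP[->|[v [B [vn _ _ _ ->]]]] [l lC ->]]|xn].
- by move: lC; rewrite inE => /eqP->/=; rewrite prednK.
- move: lC; rewrite mem_falsified_clause => /andP[+ _].
  rewrite mem_scope => /or3P[/eqP->//|/Dlt|/mult//].
  by move/ltn_trans; apply.
exists (falsified_clause (scope D mu x) [fset y in D x]).
  apply: masked_formula_scope => //.
    by rewrite in_fset_seq; apply/negP => /Dlt; rewrite ltnn.
  by move=> y; rewrite in_fset_seq.
exists (x, x \notin [fset y in D x]) => //.
by rewrite mem_falsified_clause /= mem_scope !eqxx.
Qed.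

(** All vertices are true by induction: at a first false one, the clause carrying the pattern of the
    assignment itself on the scope would be falsified. This contradicts the sink clause. *)
Lemma masked_formula_contradictory (D mu : nat -> seq nat) n : 0 < n ->
  (forall v w, w \in D v -> w < v) -> contradictory (masked_formula D mu n).
Proof.
move=> n0 Dlt a sat.
have aT v : v < n -> a v.
  elim/ltn_ind: v => v IH vn; apply: contraT => av.
  pose B := [fset x in scope D mu v | a x].
  have vB : v \notin B by rewrite in_fset_sep (negbTE av) andbF.
  have DB : {subset D v <= B}.
    move=> w wD; have wv := Dlt _ _ wD.
    by rewrite in_fset_sep mem_scope wD orbT IH // (ltn_trans wv).
  have [l] := sat _ (@masked_formula_scope D mu n v B vn vB DB).
  rewrite mem_falsified_clause => /andP[lW /eqP].
  by rewrite in_fset_sep lW /= => -> /esym; case: (a _).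
have /sat[l] : [fset (n.-1, false)] \in masked_formula D mu n.
  by apply/masked_formulaP; left.
by rewrite inE => /eqP->/=; rewrite aT // prednK.
Qed.

(** On the spine of the decision tree [rho] says that all vertices below [v] are true. The branch
    where [v] is false queries [mu v] completely; the spine ends at the sink clause. *)
Lemma masked_formula_refutable (D mu : nat -> seq nat) n m :
  0 < n -> (forall v, size (mu v) <= m) ->
  (forall v w, w \in D v -> w < v) ->
  refutable (masked_formula D mu n) [::] (n * 2 ^ m.+1).+1.
Proof.
move=> n0 sm Dlt.
have spine r v rho : v + r = n -> uniq [seq l.1 | l <- rho] ->
    (forall l, (l \in rho) = (l.1 < v) && l.2) ->
    refutable (masked_formula D mu n) rho (r * 2 ^ m.+1).+1.
  elim: r v rho => [|r IH] v rho vr urho rhoE.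
    apply: (@refutable_leaf _ _ [fset (n.-1, false)]).
      by apply/masked_formulaP; left.
    by move=> l; rewrite inE => /eqP->; rewrite rhoE /=; lia.
  have vrho : v \notin [seq l.1 | l <- rho].
    by apply/mapP => -[l]; rewrite rhoE => /andP[+ _] vl; rewrite -vl ltnn.
  have tr : refutable (masked_formula D mu n) ((v, true) :: rho) (r * 2 ^ m.+1).+1.
    apply: (IH v.+1); first by lia.
      by rewrite /= vrho.
    move=> [x b]; rewrite inE rhoE xpair_eqE /= [x < v.+1]ltnS [x <= v]leq_eqVlt.
    by case: b; rewrite ?andbT ?andbF.
  have fa : refutable (masked_formula D mu n) ((v, false) :: rho) (2 ^ (size (mu v)).+1).-1.
    apply: refutable_complete_tree; first by rewrite /= vrho.
    move=> rho' u' sub mu'.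
    have cons x b b' : (x, b) \in rho' -> (x, b') \in rho' -> b = b'.
      have := u'; elim: rho' {sub mu' u'} => // -[y c] rho' IH' /= /andP[yr u'].
      rewrite !inE !xpair_eqE => /orP[/andP[/eqP-> /eqP->]|xb] /orP[/andP[/eqP]|xb'].
      - by move=> _ /eqP->.
      - by case/mapP: yr; exists (y, b').
      - by move=> xy _; case/mapP: yr; exists (x, b).
      - exact: IH'.
    pose B := [fset x in scope D mu v | (x, true) \in rho'].
    have trueD w : w \in D v -> (w, true) \in rho'.
      by move=> /Dlt wv; apply: sub; rewrite inE rhoE wv orbT.
    have falsev : (v, false) \in rho' by apply: sub; rewrite mem_head.
    apply: (@refutable_leaf _ _ (falsified_clause (scope D mu v) B)).
      apply: masked_formula_scope; first by lia.
        by rewrite in_fset_sep; apply/negP => /andP[_ /(cons _ _ _ falsev)].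
      by move=> w wD; rewrite in_fset_sep mem_scope trueD // wD orbT.
    move=> [x b]; rewrite mem_falsified_clause => /= /andP[xW /eqP->].
    have /mapP[[y c] yr /= xy] : x \in [seq l.1 | l <- rho'].
      move: xW; rewrite mem_scope => /or3P[/eqP->|/trueD xr|/mu'//].
        by apply/mapP; exists (v, false).
      by apply/mapP; exists (x, true).
    rewrite negbK in_fset_sep xW /= xy; case: c yr => yr; first by rewrite yr.
    by case: (boolP ((y, true) \in rho')) => // /(cons _ _ _ yr).
  apply: refutable_leq (refutable_node vrho fa tr).
  (* The node on the spine is paid for by the [.-1] in the size of the complete tree. *)
  have : 2 ^ (size (mu v)).+1 <= 2 ^ m.+1 by rewrite leq_exp2l // ltnS sm.
  have : 0 < 2 ^ (size (mu v)).+1 by rewrite expn_gt0.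
  rewrite mulSn; lia.
by apply: (spine n 0).
Qed.

(** At each scale a copy of the expander [h j] leads from every block to the preceding one. The
    filter excludes block 0, whose truncated [.-1] would be block 0 itself. *)
Definition block_preds (h : nat -> nat -> seq nat) (k v : nat) : seq nat :=
  flatten [seq [seq (v %/ 2 ^ j).-1 * 2 ^ j + i | i <- h j (v %% 2 ^ j)]
          | j <- iota 0 k & 0 < v %/ 2 ^ j].

Lemma block_preds_lt (h : nat -> nat -> seq nat) k v w : (forall j i x, x \in h j i -> x < 2 ^ j) ->
  w \in block_preds h k v -> w < v.
Proof.
move=> hlt /flatten_mapP[j]; rewrite mem_filter => /andP[v0 _] /mapP[i /hlt i2 ->].
apply: leq_trans (leq_trunc_div v (2 ^ j)); rewrite -[in leqRHS](prednK v0) mulSn; lia.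
Qed.

Lemma size_block_preds (h : nat -> nat -> seq nat) k v m : (forall j i, size (h j i) <= m) ->
  size (block_preds h k v) <= k * m.
Proof.
move=> hm; rewrite size_flatten /shape -map_comp sumnE big_map big_filter.
apply: (@leq_trans (\sum_(j <- iota 0 k) m)).
  rewrite big_mkcond; apply: leq_sum => j _; case: ifP => //= _.
  by rewrite size_map.
by rewrite big_const_seq count_predT size_iota iter_addn_0 mulnC.
Qed.

Lemma block_preds_expanding (h : nat -> nat -> seq nat) k :
  (forall j (E F : {set 'I_(2 ^ j)}), 2 ^ j <= 8 * #|E| -> 2 ^ j <= 8 * #|F| ->
    exists i i' : 'I_(2 ^ j), [/\ i \in E, i' \in F & (i' : nat) \in h j i]) ->
  block_expanding (block_preds h k) k.
Proof.
move=> hE j a E F jk E8 F8; have [i [i' [iE i'F ih]]] := hE j E F E8 F8.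
exists i, i'; split=> //; apply/flatten_mapP; exists j.
  by rewrite mem_filter mem_iota jk divnMDl ?expn_gt0.
by rewrite divnMDl ?expn_gt0 // divn_small // addn0 modnMDl modn_small //; apply: map_f.
Qed.

(** The vertices whose mask misses [F] have no edge into [F], so in an expander they form a set of
    density below 1/8. *)
Lemma mask_exists g n : 0 < g -> 0 < n -> exists mu : nat -> seq nat,
  [/\ forall v, size (mu v) <= 17 * g, forall v w, w \in mu v -> w < n
    & forall F : seq nat, uniq F -> all (fun x => x < n) F -> n <= g * size F ->
        8 * count (fun v => ~~ has (mem F) (mu v)) (iota 0 n) < n].
Proof.
move=> g0 n0; have [mu [mus mult muE]] := expander g0 n0.
exists mu; split=> // F uF FN Fg; rewrite ltnNge; apply/negP => E8.
have [||i [i' [iE i'F ii']]] := muE [set v : 'I_n | ~~ has (mem F) (mu v)]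
    [set v : 'I_n | (v : nat) \in F].
- rewrite cardE /enum_mem size_filter -enumT.
  move: E8; rewrite -val_enum_ord count_map.
  by rewrite (eq_count (a2 := mem [set v : 'I_n | ~~ has (mem F) (mu v)])) // => v; rewrite /= inE.
- rewrite cardE -(size_map val); apply: leq_trans Fg _; rewrite leq_mul2l; apply/orP; right.
  apply: uniq_leq_size => // x xF; have xn := allP FN x xF.
  by apply/mapP; exists (Ordinal xn) => //; rewrite mem_enum inE.
move: iE i'F; rewrite !inE => /hasPn/(_ _ ii')/negP.
exact.
Qed.

(** * Asymptotics *)

Local Close Scope fset_scope.
Local Open Scope classical_set_scope.
Local Open Scope ring_scope.

Lemma leq_mul224_exp2 k : (12 <= k)%N -> (224 * k <= 2 ^ k)%N.
Proof.
elim: k => // k IH; rewrite leq_eqVlt => /orP[/eqP[<-]|]; first by vm_compute.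
by move=> /[dup] /IH; rewrite expnS; lia.
Qed.

Lemma log2_ge (R : realType) k : (k%:R : R) <= log2 (2 ^ k).+1%:R.
Proof.
rewrite /log2 ler_pdivlMr; last by rewrite ln_gt0 // ltr1n.
rewrite mulr_natl -lnXn // ler_ln ?posrE ?exprn_gt0 //.
by rewrite -natrX ler_nat.
Qed.

(** A bound [n ^ c] is enough, since [log2 n >= 1] makes the exponent at least [c]. *)
Lemma natr_le_powR (R : realType) (m c k : nat) : (0 < k)%N ->
  (m <= (2 ^ k) ^ c)%N ->
  (m%:R : R) <= (2 ^ k).+1%:R `^ (c%:R * log2 (2 ^ k).+1%:R ^+ 4).
Proof.
move=> k0 mc; set n := (2 ^ k).+1.
have n1 : (1 : R) <= n%:R by rewrite ler1n.
have L1 : (1 : R) <= log2 n%:R by apply: le_trans (log2_ge R k); rewrite ler1n.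
apply: (@le_trans _ _ (n%:R `^ c%:R)); last first.
  by apply: ler_powR => //; rewrite ler_peMr // exprn_ege1.
rewrite powR_mulrn ?ler0n // -natrX ler_nat (leq_trans mc) //.
by case: c {mc} => // c; rewrite leq_exp2r.
Qed.

Lemma natr_le_log2X (R : realType) (m c k : nat) : (0 < k)%N -> (m <= c * k)%N ->
  (m%:R : R) <= c%:R * log2 (2 ^ k).+1%:R ^+ 5.
Proof.
move=> k0 mc; have kL := log2_ge R k.
have L1 : (1 : R) <= log2 (2 ^ k).+1%:R by apply: le_trans kL; rewrite ler1n.
apply: (@le_trans _ _ (c * k)%:R); first by rewrite ler_nat.
rewrite natrM ler_wpM2l // (le_trans kL) // exprS ler_peMr ?exprn_ege1 //.
exact: le_trans L1.
Qed.

(** The factor 2 absorbs the passage from [2 ^ k] to [2 ^ k + 1]. *)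
Lemma natr_ge_div_log2 (R : realType) (m c k : nat) : (0 < k)%N -> (0 < c)%N ->
  (2 ^ k <= c * k * m)%N ->
  (2 * c)%:R^-1 * ((2 ^ k).+1%:R / log2 (2 ^ k).+1%:R) <= (m%:R : R).
Proof.
move=> k0 c0 cm; have kL := log2_ge R k; set L := log2 _ in kL *.
have k0' : (0 : R) < k%:R by rewrite ltr0n.
have L0 : 0 < L by apply: lt_le_trans kL.
rewrite ler_pdivrMl ?ltr0n ?muln_gt0 ?c0 // ler_pdivrMr //.
apply: (@le_trans _ _ ((2 * c)%:R * m%:R * k%:R)); last by rewrite ler_wpM2l.
rewrite -!natrM ler_nat; have : (0 < 2 ^ k)%N by rewrite expn_gt0.
nia.
Qed.

Theorem theorem7p4 (R : realType) :
  exists (Sigma : nat -> clause_set) (n : nat -> nat),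
    [/\ forall i, contradictory (Sigma i),
        (forall i, (0 < n i)%N) /\ n @ \oo --> \oo,
        [/\ forall i, #|` vars (Sigma i)|%fset = (n i).-1,
            exists2 c : R, 0 < c & \forall i \near \oo,
              #|` Sigma i|%fset%:R <= (n i)%:R `^ (c * log2 (n i)%:R ^+ 4)
          & exists2 c : R, 0 < c & \forall i \near \oo,
              forall C, C \in Sigma i ->
                (width C)%:R <= c * log2 (n i)%:R ^+ 5],
        exists p : nat -> proof,
          (forall i, [/\ refutation (Sigma i) (p i), regular (p i)
                       & tree_style (p i)]) /\
          exists2 c : R, 0 < c & \forall i \near \oo,
            (size (p i))%:R <= (n i)%:R `^ (c * log2 (n i)%:R ^+ 4)
      & exists2 c : R, 0 < c & \forall i \near \oo,
          forall p : proof, refutation (Sigma i) p -> regular p ->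
            exists2 C, C \in proof_clauses p &
              c * ((n i)%:R / log2 (n i)%:R) <= (width C)%:R].
Proof.
have /choice[h hP] j : exists h : nat -> seq nat,
    [/\ forall i, (size (h i) <= 17 * 8)%N, forall i w, w \in h i -> (w < 2 ^ j)%N
      & forall E F : {set 'I_(2 ^ j)}, (2 ^ j <= 8 * #|E|)%N -> (2 ^ j <= 8 * #|F|)%N ->
          exists i i' : 'I_(2 ^ j), [/\ i \in E, i' \in F & (i' : nat) \in h i]].
  by apply: expander; rewrite // expn_gt0.
have /choice[mu muP] i : exists mu : nat -> seq nat,
    [/\ forall v, (size (mu v) <= 17 * (448 * i.+1))%N,
        forall v w, w \in mu v -> (w < 2 ^ i.+1)%N
      & forall F : seq nat, uniq F -> all (fun x => x < 2 ^ i.+1)%N F ->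
          (2 ^ i.+1 <= 448 * i.+1 * size F)%N ->
          (8 * count (fun v => ~~ has (mem F) (mu v)) (iota 0 (2 ^ i.+1)) < 2 ^ i.+1)%N].
  by apply: mask_exists; rewrite // expn_gt0.
pose D i := block_preds h i.+1.
pose Sigma i := masked_formula (D i) (mu i) (2 ^ i.+1).
have N0 i : (0 < 2 ^ i.+1)%N by rewrite expn_gt0.
have Dlt i v w : w \in D i v -> (w < v)%N.
  by apply: block_preds_lt => j a x; have [_ + _] := hP j; apply.
have muN i v w : w \in mu i v -> (w < 2 ^ i.+1)%N by have [_ + _] := muP i; apply.
have [M [M0 scopeM muM]] : exists M, [/\ (0 < M)%N,
    forall i v, (#|` scope (D i) (mu i) v|%fset <= M * i.+1)%N
    & forall i v, (size (mu i v) <= M * i.+1)%N].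
  (* The summands account for [v] itself, its predecessors over all scales, and its mask. *)
  exists (1 + 17 * 8 + 17 * 448)%N; split=> // i v; have [+ _ _] := muP i => /(_ v).
    have : (size (D i v) <= i.+1 * (17 * 8))%N.
      by apply: size_block_preds => j a; have [+ _ _] := hP j; apply.
    have := card_scope (D i) (mu i) v; lia.
  lia.
have varsE i : vars (Sigma i) = [fset x in iota 0 (2 ^ i.+1)]%fset.
  by apply: masked_formula_vars; [exact: N0|exact: Dlt|exact: muN].
(* There is one variable per vertex, so [n - 1] is the number of vertices. *)
exists Sigma, (fun i => (2 ^ i.+1).+1); split.
- by move=> i; apply: masked_formula_contradictory; [exact: N0|exact: Dlt].
- split=> //; apply/cvgnyPge => A; near=> i.
  have : (A <= i)%N by near: i; exact: nbhs_infty_ge.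
  have := ltn_expl i.+1 (isT : (1 < 2)%N); lia.
- split.
  + by move=> i; rewrite varsE card_fseq undup_id ?iota_uniq // size_iota.
  (* With [k = i + 1] there are at most [2 ^ k * 2 ^ (M * k) + 1] clauses, which is at most
     [(2 ^ k) ^ (M + 2)]. *)
  + exists (M + 2)%:R; first by rewrite ltr0n addn2.
    apply: nearW => i; apply: natr_le_powR => //.
    apply: leq_trans (masked_formula_card _ (scopeM i)) _.
    rewrite -expnD -expnM; apply: (@leq_trans (2 ^ (i.+1 + M * i.+1).+1)).
      by rewrite expnS; have : (0 < 2 ^ (i.+1 + M * i.+1))%N; rewrite ?expn_gt0 //; lia.
    by rewrite leq_exp2l //; lia.
  + exists M%:R; first by rewrite ltr0n.
    apply: nearW => i C CS; apply: natr_le_log2X => //.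
    by apply: masked_formula_width (scopeM i) _ CS; rewrite muln_gt0 M0.
- have /choice[p pP] i := refutable_refutation
    (masked_formula_refutable (N0 i) (muM i) (Dlt i)).
  exists p; split; first by move=> i; have [] := pP i.
  exists (M + 3)%:R; first by rewrite ltr0n addn3.
  apply: nearW => i; apply: natr_le_powR => //.
  have [_ _ _ /leq_trans] := pP i; apply.
  rewrite -expnD -expnM; apply: (@leq_trans (2 ^ (i.+1 + (M * i.+1).+1).+1)).
    by rewrite expnS; have : (0 < 2 ^ (i.+1 + (M * i.+1).+1))%N; rewrite ?expn_gt0 //; lia.
  by rewrite leq_exp2l //; lia.
- exists (2 * 448)%:R^-1; first by rewrite invr_gt0 ltr0n.
  near=> i => p refp regp.
  have ibig : (224 * i.+1 <= 2 ^ i.+1)%N.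
    by apply: leq_mul224_exp2; rewrite ltnS; near: i; exact: nbhs_infty_ge.
  have [|||||C Cp wC] := @regular_width (Sigma i) p (D i) (mu i) i.+1 _ _ ibig _ _ _ refp regp.
  - by [].
  - by apply: block_preds_expanding => j E F; have [_ _] := hP j; apply.
  - move=> F uF FN Fs; have [_ _ /(_ F uF FN Fs)] := muP i; lia.
  - by move=> x; rewrite varsE in_fset_seq mem_iota.
  (* The sink clause cannot be the falsified one, because the sink is false under [P]. *)
  - move=> P C /masked_formulaP[->|[v [B [vn BW vB DB ->]]]] Pt fals.
      by have := fals ((2 ^ i.+1).-1, false); rewrite inE eqxx Pt => /(_ isT).
    rewrite falsified_clause_vars; exists v; split.
    + by rewrite mem_scope eqxx.
    + by move=> w wmu; rewrite mem_scope wmu !orbT.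
    + have := fals (v, v \notin B); rewrite mem_falsified_clause mem_scope !eqxx /= vB.
      by move=> /(_ isT)/eqP.
    + move=> w wD; have := fals (w, w \notin B).
      rewrite mem_falsified_clause mem_scope wD orbT eqxx /= DB //.
      by move=> /(_ isT)/eqP->.
  by exists C => //; exact: natr_ge_div_log2.
Unshelve. all: by end_near.
Qed.
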